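(* Let $\varphi:B\to A$ be an affine mapping between real finite-dimensional affine spaces, let $m\in\mathrm{Met}(A)$ be a metric, and suppose that the induced metric $\bar m=\varphi_{\mathrm{Met}}\,m\in\mathrm{Met}(B)$ is non-null. Then the Cayley–Menger bilinear forms $\mathrm{CM}_m$ (associated to $m$) and $\mathrm{CM}_{\bar m}$ (associated to $\bar m$) satisfy $$\mathrm{CM}_{\bar m}(\bar v,\bar w)=\mathrm{CM}_m(\varphi_{\mathrm{Quad}}^*\bar v,\varphi_{\mathrm{Quad}}^*\bar w)\qquad\text{for all }\bar v,\bar w\in\mathrm{Aff}(\mathrm{Quad}_{\bar m}B).$$
   Context: All spaces are real and finite-dimensional. For an affine space $A$ with director vector space $\vec A$: $\mathrm{Aff}(A)$ is the vector space of affine functions $A\to\mathbb R$, $u$ the constant function $1$. The linear hull is $\widehat A=(\mathrm{Aff}(A))^*$; $z_P\in\widehat A$ is evaluation at $P$; $A$ is identified with $\{z:\langle z,u\rangle=1\}$ and $\vec A$ with $\{z:\langle z,u\rangle=0\}$, $\overrightarrow{PQ}=z_Q-z_P$. A function $\delta:A\to\mathbb R$ is quadratic if $\delta(\alpha P+\beta Q)=\alpha(\alpha-\beta)\delta(P)+\beta(\beta-\alpha)\delta(Q)+4\alpha\beta\,\delta(\frac{P+Q}2)$ whenever $\alpha+\beta=1$; $\mathrm{Quad}(A)$ is the vector space of quadratic functions. Each $\delta\in\mathrm{Quad}(A)$ has a symmetric bilinear form $\mathrm{Hess}\,\delta$ on $\vec A$ (hessian principal component), characterized by $\frac12(\delta(Q)+\delta(2P-Q))-\delta(P)=\frac12\mathrm{Hess}\,\delta(\overrightarrow{PQ},\overrightarrow{PQ})$.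 $\mathrm{Met}(A)=\mathrm{Quad}(A)/\mathrm{Aff}(A)$ is the space of metrics; for $m\in\mathrm{Met}(A)$, $\mathrm{Quad}_mA\subset\mathrm{Quad}(A)$ is the class $m$, an affine space with director space $\mathrm{Aff}(A)$; its elements share the same hessian principal component $g$ (that of $m$). $m$ is null if $m=0$. $\mathrm{Aff}(\mathrm{Quad}_mA)$ is the vector space of affine functionals $\mathrm{Quad}_mA\to\mathbb R$, containing $v_P(\delta)=\delta(P)$ for $P\in A$. $\mathrm d_m:\mathrm{Aff}(\mathrm{Quad}_mA)\to\widehat A$ is given by $\langle\mathrm d_m\bar v,s\rangle=\bar v(\delta+s)-\bar v(\delta)$, $s\in\mathrm{Aff}(A)$ (any $\delta\in\mathrm{Quad}_mA$). $\mathrm{Aff}_0(\mathrm{Quad}_mA)$ is the subspace of $\bar v$ with $\bar v(\delta+\alpha u)=\bar v(\delta)$ for all $\delta,\alpha$; $\mathrm d_m$ maps it into $\vec A$. For $m\neq0$ the Cayley–Menger form $\mathrm{CM}_m$ is the unique symmetric bilinear form on $\mathrm{Aff}(\mathrm{Quad}_mA)$ with (1) $\mathrm{CM}_m(v_1,v_2)=-g(\mathrm d_mv_1,\mathrm d_mv_2)$ for $v_1,v_2\in\mathrm{Aff}_0(\mathrm{Quad}_mA)$ and (2) $\mathrm{CM}_m(v_P,v_P)=0$ for all $P\in A$. Given an affine map $\varphi:B\to A$: $\varphi_{\mathrm{Quad}}:\mathrm{Quad}(A)\to\mathrm{Quad}(B)$ is $\delta\mapsto\delta\circ\varphi$; it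 maps $\mathrm{Aff}(A)$ into $\mathrm{Aff}(B)$ and so induces $\varphi_{\mathrm{Met}}:\mathrm{Met}(A)\to\mathrm{Met}(B)$; with $\bar m=\varphi_{\mathrm{Met}}m$ (non-null implies $m$ non-null) it restricts to an affine map $\mathrm{Quad}_mA\to\mathrm{Quad}_{\bar m}B$, and $\varphi_{\mathrm{Quad}}^*:\mathrm{Aff}(\mathrm{Quad}_{\bar m}B)\to\mathrm{Aff}(\mathrm{Quad}_mA)$ is the linear map $\bar v\mapsto\bar v\circ\varphi_{\mathrm{Quad}}$. *)

(* Defs.v *)
From HB Require Import structures.
From mathcomp Require Import all_boot all_order all_algebra.
From mathcomp Require Import generic_quotient ring_quotient sesquilinear.
From mathcomp Require Import boolp classical_sets functions reals.
From mathcomp Require Import ring.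

Set Implicit Arguments.
Unset Strict Implicit.
Unset Printing Implicit Defensive.

Import GRing.Theory Num.Theory.

Local Open Scope ring_scope.
Local Open Scope quotient_scope.
Local Open Scope classical_set_scope.

(* [shift P x] is [P + x] and [vec P Q] is the vector from [P] to [Q].  The
   director space is only an lmodType, so that the class of a metric is an
   affine space directed by [Aff A]; finite dimension is imposed by taking the
   director of the basic spaces in a vectType. *)
HB.mixin Record isAffine (R : realType) (V : lmodType R) (A : Type) := {
  shift : A -> V -> A;
  vec : A -> A -> V;
  affine_inhabited : exists P : A, True;
  shift0 : forall P, shift P 0 = P;
  shiftD : forall P x y, shift P (x + y) = shift (shift P x) y;
  shift_vec : forall P Q, shift P (vec P Q) = Q;
  vec_shift : forall P x, vec P (shift P x) = x
}.

#[short(type="affineType")]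
HB.structure Definition Affine (R : realType) (V : lmodType R) :=
  {A of isAffine R V A}.

Arguments shift {R V A} : rename.
Arguments vec {R V A} : rename.

(* The point [a P + b Q]; only used when [a + b = 1], so [a] is redundant. *)
Definition bary (R : realType) (V : lmodType R) (A : affineType V)
  (a : R) (P : A) (b : R) (Q : A) : A := shift P (b *: vec P Q).

Definition midpoint (R : realType) (V : lmodType R) (A : affineType V)
  (P Q : A) : A := bary 2^-1 P 2^-1 Q.

Section AffineFunctions.
Context (R : realType) (V : lmodType R) (A : affineType V).
Implicit Types (P Q : A) (x y : V).

Definition is_affine (f : A -> R^o) : Prop := forall (a b : R) P Q,
  a + b = 1 -> f (bary a P b Q) = a * f P + b * f Q.

Definition is_quadratic (d : A -> R^o) : Prop := forall (a b : R) P Q,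
  a + b = 1 -> d (bary a P b Q) =
    a * (a - b) * d P + b * (b - a) * d Q + 4 * a * b * d (midpoint P Q).

Definition affine_pred : {pred (A -> R^o)} := fun f => `[< is_affine f >].
Definition quad_pred : {pred (A -> R^o)} := fun d => `[< is_quadratic d >].

Fact affine_pred_submod : subsemimod_closed affine_pred.
Proof.
split; first split.
- by apply/asboolP => a b P Q _; rewrite !mulr0 addr0.
- move=> f g /asboolP hf /asboolP hg; apply/asboolP => a b P Q ab.
  by rewrite !addrfctE (hf a) // (hg a) //; ring.
- move=> k f /asboolP hf; apply/asboolP => a b P Q ab.
  by rewrite scalrfctE (hf a) // /GRing.scale/=; ring.
Qed.

Fact quad_pred_submod : subsemimod_closed quad_pred.
Proof.
split; first split.
- by apply/asboolP => a b P Q _; rewrite !mulr0 !addr0.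
- move=> f g /asboolP hf /asboolP hg; apply/asboolP => a b P Q ab.
  by rewrite !addrfctE (hf a) // (hg a) //; ring.
- move=> k f /asboolP hf; apply/asboolP => a b P Q ab.
  by rewrite scalrfctE (hf a) // /GRing.scale/=; ring.
Qed.

HB.instance Definition _ :=
  GRing.isSubmodClosed.Build R (A -> R^o) affine_pred affine_pred_submod.
HB.instance Definition _ :=
  GRing.isSubmodClosed.Build R (A -> R^o) quad_pred quad_pred_submod.

Record Aff := MkAff { aff_fun :> A -> R^o; _ : aff_fun \in affine_pred }.
HB.instance Definition _ := [isSub for aff_fun].
HB.instance Definition _ := [Choice of Aff by <:].
HB.instance Definition _ := [SubChoice_isSubLmodule of Aff by <:].

Record Quad := MkQuad { quad_fun :> A -> R^o; _ : quad_fun \in quad_pred }.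
HB.instance Definition _ := [isSub for quad_fun].
HB.instance Definition _ := [Choice of Quad by <:].
HB.instance Definition _ := [SubChoice_isSubLmodule of Quad by <:].

Lemma is_affine_quadratic (f : A -> R^o) : is_affine f -> is_quadratic f.
Proof.
move=> hf a b P Q ab; rewrite (hf a) // /midpoint (hf 2^-1).
  by rewrite -[a](addrK b) ab; field.
by field.
Qed.

Fact Aff_quad (f : Aff) : (f : A -> R^o) \in quad_pred.
Proof. by apply/asboolP/is_affine_quadratic/asboolP; case: f. Qed.

Definition quad_of_aff (f : Aff) : Quad := MkQuad (Aff_quad f).

Fact const_aff (c : R) : (fun _ : A => c : R^o) \in affine_pred.
Proof. by apply/asboolP => a b P Q ab; rewrite -mulrDl ab mul1r. Qed.

Definition aff1 : Aff := MkAff (const_aff 1).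

(* The subspace [Aff A] of [Quad A]. *)
Definition quad_affine : {pred Quad} := fun d => quad_fun d \in affine_pred.

Fact quad_affine_zmod : zmod_closed quad_affine.
Proof.
split; first exact: rpred0.
by move=> d e hd he; rewrite unfold_in /=; exact: rpredB.
Qed.

HB.instance Definition _ :=
  GRing.isZmodClosed.Build Quad quad_affine quad_affine_zmod.

Definition Met := Quotient.quot (quad_affine : zmodClosed Quad).
HB.instance Definition _ := Choice.on Met.
HB.instance Definition _ := GRing.Zmodule.on Met.
HB.instance Definition _ := EqQuotient.on Met.

End AffineFunctions.

Arguments affine_pred {R V A}.
Arguments quad_pred {R V A}.
Arguments quad_affine {R V A}.

Section Dual.
Context (R : realType) (U : lmodType R).

Definition scalar_pred : {pred (U -> R^o)} := fun z => `[< scalar z >].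

Fact scalar_pred_submod : subsemimod_closed scalar_pred.
Proof.
split; first split.
- by apply/asboolP => a x y; rewrite /= mulr0 addr0.
- move=> f g /asboolP hf /asboolP hg; apply/asboolP => a x y.
  by rewrite !addrfctE hf hg /= mulrDr addrACA.
- move=> k f /asboolP hf; apply/asboolP => a x y.
  by rewrite scalrfctE hf /= /GRing.scale/=; ring.
Qed.

HB.instance Definition _ :=
  GRing.isSubmodClosed.Build R (U -> R^o) scalar_pred scalar_pred_submod.

Record dual := MkDual { dual_fun :> U -> R^o; _ : dual_fun \in scalar_pred }.
HB.instance Definition _ := [isSub for dual_fun].
HB.instance Definition _ := [Choice of dual by <:].
HB.instance Definition _ := [SubChoice_isSubLmodule of dual by <:].

End Dual.

Section LinearPart.
Context (R : realType) (V : lmodType R) (A : affineType V).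
Implicit Types (P Q : A) (x y : V) (f : Aff A).

Definition base_point : A := sval (cid (@affine_inhabited R V A)).

Lemma affE f (a b : R) P Q :
  a + b = 1 -> f (bary a P b Q) = a * f P + b * f Q.
Proof. by move=> ab; have /asboolP hf := valP f; apply: hf. Qed.

Lemma vec_shift2 P x y : vec (shift P x) (shift P y) = y - x.
Proof.
by rewrite -[in shift P y](subrK x y) addrC shiftD vec_shift.
Qed.

Lemma bary_shift P x y (a b : R) : a + b = 1 ->
  bary a (shift P x) b (shift P y) = shift P (a *: x + b *: y).
Proof.
move=> ab; rewrite /bary vec_shift2 -shiftD; congr shift.
have -> : a = 1 - b by rewrite -ab addrK.
by rewrite scalerBl scale1r scalerBr addrA addrAC.
Qed.

Lemma aff_shift_scalar f P : scalar (fun x => f (shift P x) - f P : R^o).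
Proof.
have hZ (c : R) x : f (shift P (c *: x)) - f P = c * (f (shift P x) - f P).
  have /(affE f (shift P 0) (shift P x)) : (1 - c) + c = 1 by ring.
  rewrite bary_shift ?subrK // scaler0 add0r shift0 => ->; ring.
have hD x y : f (shift P (x + y)) - f P =
    (f (shift P x) - f P) + (f (shift P y) - f P).
  have h2 : (2^-1 : R) + 2^-1 = 1 by field.
  have /(affE f (shift P (2 *: x)) (shift P (2 *: y))) := h2.
  rewrite bary_shift // !scalerA mulVf ?pnatr_eq0 // !scale1r => ->.
  have := hZ 2 x; have := hZ 2 y => /eqP; rewrite subr_eq => /eqP ->.
  by move/eqP; rewrite subr_eq => /eqP ->; field.
by move=> c x y /=; rewrite hD hZ.
Qed.

Fact lin_part_scalar f :
  (fun x => f (shift base_point x) - f base_point : R^o) \in @scalar_pred R V.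
Proof. exact/asboolP/aff_shift_scalar. Qed.

(* The choice of the base point is immaterial: see [lin_partE]. *)
Definition lin_part f : dual V := MkDual (lin_part_scalar f).

Lemma lin_partE f P x : lin_part f x = f (shift P x) - f P.
Proof.
rewrite /lin_part /=; set O := base_point.
have hD := aff_shift_scalar f O.
rewrite -(shift_vec O P) -shiftD.
have := hD 1 (vec O P) x; rewrite scale1r /= mul1r => /eqP.
by rewrite subr_eq => /eqP ->; ring.
Qed.

End LinearPart.

Section Hull.
Context (R : realType) (V : lmodType R) (A : affineType V).
Implicit Types (P Q : A) (x y : V) (z : dual (Aff A)).

Definition hull := dual (Aff A).

Fact point_scalar P : (fun s : Aff A => s P) \in @scalar_pred R (Aff A).
Proof. by apply/asboolP. Qed.

Definition point_hull P : hull := MkDual (point_scalar P).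

(* The embedding of the director space as the hyperplane [z u = 0]. *)
Definition vec_hull x : hull :=
  point_hull (shift (base_point A) x) - point_hull (base_point A).

Lemma vec_hullE x (s : Aff A) : vec_hull x s = lin_part s x.
Proof. by []. Qed.

Lemma vec_hull_vec P Q : vec_hull (vec P Q) = point_hull Q - point_hull P.
Proof.
apply/val_inj/funext => s; rewrite [LHS]vec_hullE (lin_partE s P) shift_vec.
by [].
Qed.

(* The inverse identification, meaningful when [z u = 0]. *)
Definition hull_vec (z : hull) : V := xget 0 [set x | vec_hull x = z].

End Hull.

Definition sym_bilinear (R : realType) (U : lmodType R) (b : U -> U -> R) :=
  bilinear_for *%R *%R b /\ (forall x y, b x y = b y x).

Section Metrics.
Context (R : realType) (V : lmodType R) (A : affineType V).
Implicit Types (P Q : A) (d : Quad A) (m : Met A).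

Definition is_hess d (g : V -> V -> R) : Prop :=
  sym_bilinear g /\
  forall P Q, 2^-1 * (d Q + d (bary 2 P (- 1) Q)) - d P
              = 2^-1 * g (vec P Q) (vec P Q).

Definition hess d : V -> V -> R := xget (fun _ _ => 0) [set g | is_hess d g].

Record Quadm m :=
  MkQuadm { quadm_quad :> Quad A; _ : \pi_(Met A) quadm_quad == m }.

HB.instance Definition _ m := [isSub for @quadm_quad m].

Lemma pi_Met_aff d e : (\pi_(Met A) d == \pi_(Met A) e) = (d - e \in quad_affine).
Proof. by rewrite -Quotient.idealrBE. Qed.

Fact Quadm_shift_subproof m (d : Quadm m) (s : Aff A) :
  \pi_(Met A) (quadm_quad d + quad_of_aff s) == m.
Proof.
rewrite -[X in _ == X](eqP (valP d)) /=.
rewrite pi_Met_aff addrAC subrr add0r.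
exact: (valP s).
Qed.

Definition Quadm_shift m (d : Quadm m) (s : Aff A) : Quadm m :=
  MkQuadm (Quadm_shift_subproof d s).

Fact Quadm_vec_subproof m (d e : Quadm m) :
  (quad_fun e - quad_fun d : A -> R^o) \in affine_pred.
Proof.
have : quadm_quad e - quadm_quad d \in quad_affine.
  by rewrite -pi_Met_aff (eqP (valP d)) (eqP (valP e)).
by [].
Qed.

Definition Quadm_vec m (d e : Quadm m) : Aff A :=
  MkAff (Quadm_vec_subproof d e).

Lemma Quadm_inhabited m : exists d : Quadm m, True.
Proof.
have h : \pi_(Met A) (repr m) == m by rewrite reprK.
by exists (MkQuadm h).
Qed.

Lemma Quadm_shift0 m (d : Quadm m) : Quadm_shift d 0 = d.
Proof. by do 2!apply/val_inj; apply/funext => P; apply: addr0. Qed.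

Lemma Quadm_shiftD m (d : Quadm m) s t :
  Quadm_shift d (s + t) = Quadm_shift (Quadm_shift d s) t.
Proof. by do 2!apply/val_inj; apply/funext => P; apply: addrA. Qed.

Lemma Quadm_shift_vec m (d e : Quadm m) : Quadm_shift d (Quadm_vec d e) = e.
Proof.
do 2!apply/val_inj; apply/funext => P.
exact: etrans (addrC (d P) (e P - d P)) (subrK _ _).
Qed.

Lemma Quadm_vec_shift m (d : Quadm m) s : Quadm_vec d (Quadm_shift d s) = s.
Proof.
apply/val_inj; apply/funext => P.
exact: etrans (congr1 (fun t => t - d P) (addrC (d P) (s P))) (addrK _ _).
Qed.

HB.instance Definition _ m := isAffine.Build R (Aff A) (Quadm m)
  (Quadm_inhabited m) (@Quadm_shift0 m) (@Quadm_shiftD m)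
  (@Quadm_shift_vec m) (@Quadm_vec_shift m).

(* By [lin_partE], [diff_m v s] is [v (d + s) - v d] for every [d]. *)
Definition diff_m m (v : Aff (Quadm m)) : hull A := lin_part v.

Definition Aff0 m (v : Aff (Quadm m)) : Prop :=
  forall (d : Quadm m) (a : R), v (shift d (a *: aff1 A)) = v d.

Fact eval_affine m P : (fun d : Quadm m => d P) \in affine_pred.
Proof.
apply/asboolP => a b d e ab.
rewrite -[RHS]/(a * d P + b * e P) -[LHS]/(d P + b * (e P - d P)).
by rewrite -[a](addrK b) ab; ring.
Qed.

Definition eval_at m P : Aff (Quadm m) := MkAff (eval_affine m P).

(* The hessian of [m]; any element of the class gives the same form, see
   [hess_mE]. *)
Definition hess_m m : V -> V -> R := hess (repr m).

Lemma hessE m (d e : Quadm m) : hess d = hess e.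
Proof.
suff h (a c : Quadm m) g : is_hess a g -> is_hess c g.
  by congr xget; apply/seteqP; split=> g; apply: h.
case=> gb hg; split=> // P Q; rewrite -hg.
have ac (O : A) : (c : Quad A) O = (a : Quad A) O + vec a c O.
  by rewrite -{1}(shift_vec a c).
rewrite !ac (affE (vec a c)); first by field.
by ring.
Qed.

Lemma hess_mE m (d : Quadm m) : hess_m m = hess d.
Proof.
have h : \pi_(Met A) (repr m) == m by rewrite reprK.
exact: hessE (MkQuadm h) d.
Qed.

Definition is_CM m (b : Aff (Quadm m) -> Aff (Quadm m) -> R) : Prop :=
  [/\ sym_bilinear b,
      (forall v1 v2, Aff0 v1 -> Aff0 v2 ->
         b v1 v2 = - hess_m m (hull_vec (diff_m v1)) (hull_vec (diff_m v2)))
    & (forall P, b (eval_at m P) (eval_at m P) = 0)].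

Definition CM m : Aff (Quadm m) -> Aff (Quadm m) -> R :=
  xget (fun _ _ => 0) [set b | is_CM b].

End Metrics.

Arguments CM {R V A} m.

Section AffineMaps.
Context (R : realType) (W V : lmodType R) (B : affineType W) (A : affineType V).

Definition is_affine_map (f : B -> A) : Prop := forall (a b : R) P Q,
  a + b = 1 -> f (bary a P b Q) = bary a (f P) b (f Q).

Record affine_map := AffineMap {
  affine_map_fun :> B -> A;
  affine_mapP : is_affine_map affine_map_fun
}.

End AffineMaps.

Section AffPullback.
Context (R : realType) (W V : lmodType R) (B : affineType W) (A : affineType V).
Variable phi : affine_map B A.

Fact aff_pull_subproof (f : Aff A) : (f : A -> R^o) \o phi \in affine_pred.
Proof.
by apply/asboolP => a b P Q ab; rewrite /= (affine_mapP phi) // affE.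
Qed.

Definition aff_pull (f : Aff A) : Aff B := MkAff (aff_pull_subproof f).

End AffPullback.

Section Pullback.
Context (R : realType) (W V : lmodType R) (B : affineType W) (A : affineType V).
Variable phi : affine_map B A.

Fact quad_pull_subproof (d : Quad A) : (d : A -> R^o) \o phi \in quad_pred.
Proof.
apply/asboolP => a b P Q ab; have /asboolP hd := valP d.
rewrite /= (affine_mapP phi) // (hd a) // /midpoint (affine_mapP phi) //.
by field.
Qed.

Definition quad_pull (d : Quad A) : Quad B := MkQuad (quad_pull_subproof d).

(* [quad_pull] maps [Aff A] into [Aff B], so the choice of the representative
   is immaterial: see [met_pull_pi]. *)
Definition met_pull (m : Met A) : Met B := \pi_(Met B) (quad_pull (repr m)).

Lemma met_pull_pi (d : Quad A) :
  met_pull (\pi_(Met A) d) = \pi_(Met B) (quad_pull d).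
Proof.
apply/eqP; rewrite pi_Met_aff.
set e := repr _.
have : e - d \in quad_affine by rewrite -pi_Met_aff reprK.
move=> h; exact: (aff_pull_subproof phi (MkAff h)).
Qed.

Fact quadm_pull_subproof m (d : Quadm m) :
  \pi_(Met B) (quad_pull d) == met_pull m.
Proof. by rewrite -met_pull_pi (eqP (valP d)). Qed.

Definition quadm_pull_fun m (d : Quadm m) : Quadm (met_pull m) :=
  MkQuadm (quadm_pull_subproof d).

Fact quadm_pull_affine m : is_affine_map (@quadm_pull_fun m).
Proof. by move=> a b d e ab; do 2!apply/val_inj; apply/funext. Qed.

Definition quadm_pull m : affine_map (Quadm m) (Quadm (met_pull m)) :=
  AffineMap (@quadm_pull_affine m).

(* The map [v |-> v \o quadm_pull m]. *)
Definition quad_pull_dual m (v : Aff (Quadm (met_pull m))) : Aff (Quadm m) :=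
  aff_pull (quadm_pull m) v.

End Pullback.

Arguments quad_pull_dual {R W V B A} phi m v.

(* Main.v *)
Require Import Defs.
From mathcomp Require Import all_boot all_order all_algebra.
From mathcomp Require Import boolp classical_sets reals.
From mathcomp Require Import ring lra.

Set Implicit Arguments.
Unset Strict Implicit.
Unset Printing Implicit Defensive.

Import GRing.Theory Num.Theory.

Local Open Scope ring_scope.
Local Open Scope quotient_scope.

(** The Cayley-Menger form of a non-null metric is characterized by its values
    on [Aff0], given by the hessian, and by the isotropy of the evaluations at
    points. Pulling back the form of [m] along [phi] produces a form on the
    functionals attached to the induced metric, and both properties survive:
    the dual pullback maps [Aff0] into [Aff0], acts on differentials by the
    linear part of [phi] ([hull_vec_pull]), along which the hessian is also
    pulled back ([hess_m_pull]), and it sends the evaluation at [P] to the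
    evaluation at [phi P]. This is [is_CM_pull], and the theorem follows from
    uniqueness for the induced metric.

    What has to be supplied is that the objects in this argument exist. The
    hessian of a quadratic function is its mixed second difference; restrictions
    to lines are polynomials of degree at most two, which forces second
    differences to be independent of the point ([quad_diff2]) and hence the
    mixed difference to be bilinear ([polar_form_hess]). The identification of
    the director space with a hyperplane of the linear hull uses coordinates
    ([vec_hull_inj], [vec_hull_surj]). The Cayley-Menger form is given by an
    explicit formula ([CM_exists]). Its uniqueness ([CM_unique]) uses that
    [v_(Q + x) + v_(Q - x) - 2 v_Q] is the constant functional [hess_m m x x],
    nonzero for some [x] when the metric is non-null. *)

(** * Symmetric bilinear forms *)

Section SymBilinear.
Context (R : realType) (U : lmodType R) (b : U -> U -> R).
Context (hb : sym_bilinear b).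

Lemma sym_bilinC x y : b x y = b y x.
Proof. by have [_ h] := hb; exact: h. Qed.

Lemma sym_bilinP a x y z : b (a *: x + y) z = a * b x z + b y z.
Proof. by have [[h _] _] := hb; exact: h. Qed.

Lemma sym_bilin0l z : b 0 z = 0.
Proof.
by have := sym_bilinP (- 1) 0 0 z; rewrite scaler0 addr0 mulN1r addNr.
Qed.

Lemma sym_bilinDl x y z : b (x + y) z = b x z + b y z.
Proof. by rewrite -{1}[x]scale1r sym_bilinP mul1r. Qed.

Lemma sym_bilinZl a x z : b (a *: x) z = a * b x z.
Proof. by rewrite -{1}[a *: x]addr0 sym_bilinP sym_bilin0l addr0. Qed.

Lemma sym_bilinDr x y z : b z (x + y) = b z x + b z y.
Proof. by rewrite !(sym_bilinC z) sym_bilinDl. Qed.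

Lemma sym_bilinZr a x z : b z (a *: x) = a * b z x.
Proof. by rewrite !(sym_bilinC z) sym_bilinZl. Qed.

End SymBilinear.

Lemma sym_bilin_polarization (R : realType) (U : lmodType R)
    (b c : U -> U -> R) :
  sym_bilinear b -> sym_bilinear c -> (forall x, b x x = c x x) ->
  forall x y, b x y = c x y.
Proof.
move=> hb hc h x y; have := h (x + y).
rewrite !(sym_bilinDl hb, sym_bilinDr hb, sym_bilinDl hc, sym_bilinDr hc).
by rewrite (sym_bilinC hb y) (sym_bilinC hc y) !h; lra.
Qed.

(** * The hessian of a quadratic function *)

Section Quadratic.
Context (R : realType) (V : lmodType R) (A : affineType V).
Implicit Types (P Q : A) (x y z : V) (d : Quad A).

Lemma quadE d (a b : R) P Q : a + b = 1 -> d (bary a P b Q) =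
  a * (a - b) * d P + b * (b - a) * d Q + 4 * a * b * d (midpoint P Q).
Proof. by move=> ab; have /asboolP hd := valP d; apply: hd. Qed.

(** A quadratic function is known on a line from its values at two points and
    their midpoint, hence it restricts there to a polynomial of degree at most
    two. This is the only form in which quadraticity is used to construct the
    hessian. *)
Lemma quad_line d P x : exists a b c : R,
  forall t, d (shift P (t *: x)) = a + b * t + c * (t * t).
Proof.
pose e1 := d (shift P x); pose e2 := d (shift P (2^-1 *: x)).
exists (d P), (4 * e2 - e1 - 3 * d P), (2 * d P + 2 * e1 - 4 * e2) => t.
have /(quadE d P (shift P x)) : 1 - t + t = 1 by rewrite subrK.
rewrite /midpoint /bary vec_shift => ->.
by rewrite -/e1 -/e2 /=; ring.
Qed.

(** In the plane of coordinates [(s, t)] along [x] and [y] the function has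
    degree at most two on every line, so the coefficient of [s ^+ 2 * t] is
    zero: the second difference along [x] takes the same value at the heights
    [t = 1] and [t = - 1]. Only finitely many lines are needed, namely rows,
    columns and the two diagonals. *)
Lemma quad_diff2_opp d P x y :
  d (shift P (y + x)) + d (shift P (y - x)) - 2 * d (shift P y) =
  d (shift P (- y + x)) + d (shift P (- y - x)) - 2 * d (shift P (- y)).
Proof.
pose F (s t : R) : R := d (shift P (t *: y + s *: x)).
have row t : exists a b c : R, forall s, F s t = a + b * s + c * (s * s).
  have [a [b [c h]]] := quad_line d (shift P (t *: y)) x.
  by exists a, b, c => s; rewrite -h /F shiftD.
have col s : exists a b c : R, forall t, F s t = a + b * t + c * (t * t).
  have [a [b [c h]]] := quad_line d (shift P (s *: x)) y.
  by exists a, b, c => t; rewrite -h /F addrC shiftD.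
have diag : exists a b c : R, forall t, F t t = a + b * t + c * (t * t).
  have [a [b [c h]]] := quad_line d P (y + x).
  by exists a, b, c => t; rewrite -h /F scalerDr.
have antidiag : exists a b c : R, forall t, F t (- t) = a + b * t + c * (t * t).
  have [a [b [c h]]] := quad_line d P (x - y).
  by exists a, b, c => t; rewrite -h /F scalerBr addrC scaleNr.
have -> : d (shift P (y + x)) = F 1 1 by rewrite /F !scale1r.
have -> : d (shift P (y - x)) = F (-1) 1 by rewrite /F !scaleN1r !scale1r.
have -> : d (shift P y) = F 0 1 by rewrite /F scale0r scale1r addr0.
have -> : d (shift P (- y + x)) = F 1 (-1) by rewrite /F !scaleN1r !scale1r.
have -> : d (shift P (- y - x)) = F (-1) (-1) by rewrite /F !scaleN1r.
have -> : d (shift P (- y)) = F 0 (-1) by rewrite /F scale0r scaleN1r addr0.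
(* [E] extracts the part of [F] that is even in [s] and odd in [t]. The
   diagonals make [E 2 2] equal to [2 * E 1 1], while rows and columns make it
   equal to [8 * E 1 1 - 6 * E 0 1]. *)
pose E s t := F s t + F (- s) t - F s (- t) - F (- s) (- t).
have E22 : E 2 2 = 2 * E 1 1.
  have [? [? [? h]]] := diag; have [? [? [? k]]] := antidiag.
  have := k (- 1); have := k (- 2); rewrite !opprK => k2 k1.
  by rewrite /E !h !k k1 k2; ring.
have E2t t : E 2 t = 4 * E 1 t - 3 * E 0 t.
  have [? [? [? h]]] := row t; have [? [? [? k]]] := row (- t).
  by rewrite /E oppr0 !h !k; ring.
have Es2 s : E s 2 = 2 * E s 1.
  have [? [? [? h]]] := col s; have [? [? [? k]]] := col (- s).
  by rewrite /E !h !k; ring.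
have : E 1 1 = E 0 1.
  by have := E2t 2; rewrite E22 !Es2; lra.
by rewrite /E oppr0; lra.
Qed.

(** Two points are exchanged by the reflection in their midpoint, which reduces
    the claim to opposite heights. *)
Lemma quad_diff2 d P Q x :
  d (shift P x) + d (shift P (- x)) - 2 * d P =
  d (shift Q x) + d (shift Q (- x)) - 2 * d Q.
Proof.
pose y := 2^-1 *: vec P Q; pose M := shift P y.
have yy : y + y = vec P Q.
  by rewrite /y -scalerDl (_ : 2^-1 + 2^-1 = 1 :> R) ?scale1r //; field.
have MQ z : shift M (y + z) = shift Q z.
  by rewrite /M -shiftD addrA yy shiftD shift_vec.
have MP z : shift M (- y + z) = shift P z.
  by rewrite /M -shiftD addrA subrr add0r.
have My : shift M y = Q by have := MQ 0; rewrite addr0 shift0.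
have MNy : shift M (- y) = P by have := MP 0; rewrite addr0 shift0.
by have := quad_diff2_opp d M x y; rewrite !MQ !MP My MNy.
Qed.

Definition polar d P x y : R :=
  d (shift P (x + y)) - d (shift P x) - d (shift P y) + d P.

(** With [u] and [v] the half sum and half difference of [x] and [y], the four
    points involved are [C + u], [C - u], [C + v] and [C - v], where [C] is
    [P + u]. The alternating sum is therefore a difference of two second
    differences at the same centre, and these do not depend on the centre. *)
Lemma polar_indep d P Q x y : polar d P x y = polar d Q x y.
Proof.
pose h : R := 2^-1.
have hh : h + h = 1 by rewrite /h; field.
pose u := h *: x + h *: y; pose v := h *: x - h *: y.
have uu : u + u = x + y by rewrite addrACA -!scalerDl hh !scale1r.
have uv : u + v = x by rewrite /u /v addrACA subrr addr0 -!scalerDl hh scale1r.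
have vu : u - v = y.
  rewrite /u /v opprB [h *: x + _]addrC addrACA subrr addr0.
  by rewrite -scalerDl hh scale1r.
suff polE O : polar d O x y =
    (d (shift (shift O u) u) + d (shift (shift O u) (- u)) - 2 * d (shift O u))
  - (d (shift (shift O u) v) + d (shift (shift O u) (- v)) - 2 * d (shift O u)).
  by rewrite !polE (quad_diff2 d _ (shift Q u) u)
             (quad_diff2 d _ (shift Q u) v).
by rewrite -!shiftD uu subrr uv vu shift0 /polar; ring.
Qed.


(** The base point is a mere device to get a form on vectors; by
    [polar_formE] any point may replace it. *)
Definition polar_form d x y : R := polar d (base_point A) x y.

Lemma polar_formE d P x y : polar_form d x y =
  d (shift P (x + y)) - d (shift P x) - d (shift P y) + d P.
Proof. exact: polar_indep. Qed.

Lemma polar_form_sym d x y : polar_form d x y = polar_form d y x.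
Proof. by rewrite !(polar_formE d (base_point A)) [x + y]addrC; ring. Qed.

(** Additivity is a telescoping sum in which the middle difference is based at
    the point displaced by [x], so it rests on the independence of the base
    point. *)
Lemma polar_formDl d x y z :
  polar_form d (x + y) z = polar_form d x z + polar_form d y z.
Proof.
pose O := base_point A; rewrite (polar_formE d O x) (polar_formE d O (x + y)).
by rewrite (polar_formE d (shift O x)) -!shiftD -[x + y + z]addrA; ring.
Qed.

(** As a function of the scalar, the form is additive by [polar_formDl] and a
    polynomial of degree at most two by [quad_line]; an additive polynomial in
    one real variable is linear. *)
Lemma polar_formZl d a x z :
  polar_form d (a *: x) z = a * polar_form d x z.
Proof.
pose O := base_point A; pose h t := polar_form d (t *: x) z.
have hD s t : h (s + t) = h s + h t by rewrite /h scalerDl polar_formDl.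
have [a0 [b [c hE]]] : exists a0 b c : R,
    forall t, h t = a0 + b * t + c * (t * t).
  have [a1 [b1 [c1 h1]]] := quad_line d (shift O z) x.
  have [a2 [b2 [c2 h2]]] := quad_line d O x.
  exists (a1 - a2 - d (shift O z) + d O), (b1 - b2), (c1 - c2) => t.
  by rewrite /h (polar_formE d O) [t *: x + z]addrC shiftD h1 h2; ring.
have := hD 0 0; have := hD 1 1; rewrite !hE => e1 e0.
have a00 : a0 = 0 by lra.
have c0 : c = 0 by lra.
have := hE a; have := hE 1; rewrite a00 c0 /h scale1r => -> ->; ring.
Qed.

Lemma polar_form_hess d : is_hess d (polar_form d).
Proof.
split; first split; first split=> [z|z] a x y /=.
- by rewrite polar_formDl polar_formZl.
- by rewrite !(polar_form_sym d z) polar_formDl polar_formZl.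
- exact: polar_form_sym.
move=> P Q; rewrite (polar_formE d (shift P (- vec P Q))) /bary scaleN1r.
by rewrite -!shiftD addKr addNr shift0 shift_vec; field.
Qed.

Lemma hess_is_hess d : is_hess d (hess d).
Proof.
rewrite /hess; apply: xgetPex; exists (polar_form d).
exact: polar_form_hess.
Qed.

Lemma hess_mP (m : Met A) (d : Quadm m) : is_hess d (hess_m m).
Proof. by rewrite (hess_mE d); apply: hess_is_hess. Qed.

Lemma hess_m_sym_bilinear (m : Met A) : sym_bilinear (hess_m m).
Proof. by have [d _] := Quadm_inhabited m; case: (hess_mP d). Qed.

Lemma hess_m_diff2 (m : Met A) (d : Quadm m) P x :
  d (shift P x) + d (shift P (- x)) - 2 * d P = hess_m m x x.
Proof.
have [_ /(_ P (shift P x))] := hess_mP d.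
by rewrite /bary vec_shift scaleN1r; lra.
Qed.

End Quadratic.

(** * The hessian of a metric *)

Section MetricForm.
Context (R : realType) (V : lmodType R) (A : affineType V).
Implicit Types (P Q O : A) (x y : V).

Lemma quad_affine_diff2 (d : Quad A) :
  (forall P x, d (shift P x) + d (shift P (- x)) - 2 * d P = 0) ->
  d \in quad_affine.
Proof.
move=> h; apply/asboolP => a b P Q ab.
rewrite (quadE d) // -[Q](shift_vec P); set x := 2^-1 *: vec P Q.
have hh : (2^-1 : R) + 2^-1 = 1 by field.
have -> : vec P Q = x + x by rewrite -scalerDl hh scale1r.
have := h (shift P x) x; rewrite -!shiftD subrr shift0 => e.
have -> : midpoint P (shift P (x + x)) = shift P x.
  by rewrite /midpoint /bary vec_shift scalerDr -scalerDl hh scale1r.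
have -> : a = 1 - b by rewrite -ab addrK.
have -> : (d : Quad A) (shift P x) = 2^-1 * (d (shift P (x + x)) + d P) by lra.
by field.
Qed.

(** A metric whose hessian vanishes on the diagonal consists of affine
    functions. This is how the non-nullity of a metric enters the uniqueness of
    the Cayley-Menger form. *)
Lemma hess_m_neq0 (m : Met A) : m <> 0 -> exists x, hess_m m x x <> 0.
Proof.
move=> m0; apply: contrapT => /forallNP h; apply: m0.
have [d _] := Quadm_inhabited m.
rewrite -(eqP (valP d)); apply/eqP.
have -> : (0 : Met A) = \pi_(Met A) 0 by rewrite raddf0.
rewrite pi_Met_aff subr0; apply: quad_affine_diff2 => P x.
by rewrite (hess_m_diff2 d) (contrapT (h x)).
Qed.

Lemma form_quadratic (g : V -> V -> R) O : sym_bilinear g ->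
  (fun P => 2^-1 * g (vec O P) (vec O P) : R^o) \in @quad_pred R V A.
Proof.
move=> gb; apply/asboolP => a b P Q ab.
have h2 : (2^-1 : R) + 2^-1 = 1 by field.
rewrite -[P](shift_vec O) -[Q](shift_vec O) /midpoint !bary_shift // !vec_shift.
rewrite !(sym_bilinDl gb, sym_bilinDr gb, sym_bilinZl gb, sym_bilinZr gb).
by rewrite (sym_bilinC gb (vec O Q)); field.
Qed.

(** Every metric contains a function that vanishes at a prescribed point
    together with its differential. Evaluation at this function is the linear
    functional in terms of which the Cayley-Menger form is written in [CM_exists]. *)
Lemma centred_exists (m : Met A) O : exists d : Quadm m,
  forall P, d P = 2^-1 * hess_m m (vec O P) (vec O P).
Proof.
have gb := hess_m_sym_bilinear m; have [d _] := Quadm_inhabited m.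
pose d0 := MkQuad (form_quadratic O gb).
have d0m : \pi_(Met A) d0 == m.
  rewrite -(eqP (valP d)) pi_Met_aff; apply: quad_affine_diff2 => P x.
  rewrite -[RHS](subrr (hess_m m x x)) -[in X in _ = _ - X](hess_m_diff2 d P).
  rewrite -[P](shift_vec O) -!shiftD; set y := vec O P.
  have dE Q : (d0 - quadm_quad d) Q =
      2^-1 * hess_m m (vec O Q) (vec O Q) - d Q by [].
  rewrite !dE !vec_shift.
  rewrite !(sym_bilinDl gb, sym_bilinDr gb) -[- x]scaleN1r.
  rewrite !(sym_bilinZl gb, sym_bilinZr gb) (sym_bilinC gb y).
  by field.
by exists (MkQuadm d0m).
Qed.

End MetricForm.

(** * The linear part of an affine map and induced metrics *)

Section AffineMap.
Context (R : realType) (W V : lmodType R) (B : affineType W) (A : affineType V).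
Context (phi : affine_map B A).
Implicit Types (P Q : B) (x y : W).

(** The linear part of [phi], computed at [P]; by [diff_map_indep] the point
    is immaterial. *)
Definition diff_map P x : V := vec (phi P) (phi (shift P x)).

Lemma diff_mapE P x : phi (shift P x) = shift (phi P) (diff_map P x).
Proof. by rewrite shift_vec. Qed.

Lemma shift_inj (P : A) : injective (shift P : V -> A).
Proof. by move=> x y /(congr1 (vec P)); rewrite !vec_shift. Qed.

Lemma diff_mapZ P a x : diff_map P (a *: x) = a *: diff_map P x.
Proof.
apply: (@shift_inj (phi P)); rewrite -diff_mapE.
have /(affine_mapP phi P (shift P x)) : 1 - a + a = 1 by rewrite subrK.
by rewrite /bary vec_shift.
Qed.

(** [P + (x + y)] is the midpoint of [P + 2 x] and [P + 2 y], and [phi]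
    preserves midpoints. *)
Lemma diff_mapD P x y : diff_map P (x + y) = diff_map P x + diff_map P y.
Proof.
have h2 : (2^-1 : R) + 2^-1 = 1 by field.
have half2 (U : lmodType R) (z : U) : 2^-1 *: ((2 : R) *: z) = z.
  by rewrite scalerA mulVf ?pnatr_eq0 // scale1r.
apply: (@shift_inj (phi P)).
have := affine_mapP phi (shift P (2 *: x)) (shift P (2 *: y)) h2.
by rewrite bary_shift // !half2 !diff_mapE !diff_mapZ bary_shift // !half2.
Qed.

Lemma diff_map_indep P Q x : diff_map P x = diff_map Q x.
Proof.
rewrite -[Q](shift_vec P); apply: (@shift_inj (phi (shift P (vec P Q)))).
by rewrite -[RHS]diff_mapE (diff_mapE P (vec P Q)) -!shiftD diff_mapE diff_mapD.
Qed.

Lemma hess_m_pull (m : Met A) P x y :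
  hess_m (met_pull phi m) x y = hess_m m (diff_map P x) (diff_map P y).
Proof.
move: x y; have hm := hess_m_sym_bilinear m.
apply: sym_bilin_polarization; first exact: hess_m_sym_bilinear.
  split; first split=> z a x y /=.
  - by rewrite diff_mapD diff_mapZ (sym_bilinP hm).
  - rewrite !(sym_bilinC hm (diff_map P z)).
    by rewrite diff_mapD diff_mapZ (sym_bilinP hm).
  - by move=> x y; apply: sym_bilinC.
move=> x; have [d _] := Quadm_inhabited m.
rewrite -(hess_m_diff2 (quadm_pull phi m d) P) -(hess_m_diff2 d (phi P)) /=.
by rewrite !diff_mapE -scaleN1r diff_mapZ scaleN1r.
Qed.

End AffineMap.

(** * The director space as a hyperplane of the linear hull *)

Section DualSum.
Context (R : realType) (U : lmodType R).

Lemma dualP (z : dual U) a x y : z (a *: x + y) = a * z x + z y.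
Proof. by have /asboolP := valP z; apply. Qed.

Lemma dual_sum (z : dual U) I (r : seq I) (c : I -> R) (f : I -> U) :
  z (\sum_(i <- r) c i *: f i) = \sum_(i <- r) c i * z (f i).
Proof.
elim: r => [|i r IH]; last by rewrite !big_cons dualP IH.
rewrite !big_nil; have := dualP z (- 1) 0 0.
by rewrite scaler0 addr0 mulN1r addNr.
Qed.

End DualSum.

Section Hull.
Context (R : realType) (V : vectType R) (A : affineType V).
Implicit Types (x y : V) (z : hull A).

Let O := base_point A.

Lemma vec_hull_linear a x y :
  vec_hull A (a *: x + y) = a *: vec_hull A x + vec_hull A y.
Proof. by apply/val_inj/funext => s; exact: (dualP (lin_part s) a x y). Qed.

Definition coord_fun i (P : A) : R^o := coord (vbasis fullv) i (vec O P).

Lemma coord_fun_affine i : coord_fun i \in affine_pred.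
Proof.
apply/asboolP => a b P Q ab.
rewrite -[P](shift_vec O) -[Q](shift_vec O) bary_shift // /coord_fun.
by rewrite !vec_shift linearD !linearZ.
Qed.

Definition coord_aff i : Aff A := MkAff (coord_fun_affine i).

Lemma lin_part_coord i x : lin_part (coord_aff i) x = coord (vbasis fullv) i x.
Proof.
rewrite (lin_partE _ O) /= /coord_fun vec_shift.
by rewrite -{2}(shift0 O) vec_shift linear0 subr0.
Qed.

Lemma vec_hull_inj : injective (@vec_hull R V A).
Proof.
move=> x y xy; rewrite (coord_vbasis (memvf x)) (coord_vbasis (memvf y)).
apply: eq_bigr => i _.
by rewrite -!lin_part_coord -!vec_hullE xy.
Qed.

Lemma aff_decomp (f : Aff A) : f = f O *: aff1 A +
  \sum_(i < \dim (fullv : {vspace V}))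
    lin_part f (vbasis fullv)`_i *: coord_aff i.
Proof.
apply/val_inj/funext => P; set g := (X in _ = \val X P).
rewrite -[RHS]/(point_hull P g) /g dualP dual_sum.
rewrite -[P](shift_vec O); set x := vec O P.
rewrite -[LHS]/(f (shift O x)) -[LHS](subrK (f O)) -(lin_partE f O) addrC mulr1.
rewrite {1}(coord_vbasis (memvf x)) dual_sum; congr (_ + _).
by apply: eq_bigr => i _; rewrite mulrC /= /coord_fun vec_shift.
Qed.

(** Here finite dimension matters: an affine function is a constant plus a
    combination of finitely many coordinate functions, so a functional killing
    the constants is determined by its values on the coordinates, which are the
    coordinates of the vector sought. *)
Lemma vec_hull_surj z : z (aff1 A) = 0 -> exists x, vec_hull A x = z.
Proof.
move=> zu; exists (\sum_i z (coord_aff i) *: (vbasis fullv)`_i).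
apply/val_inj/funext => f; rewrite -[LHS]/(lin_part f _) -[RHS]/(z f).
rewrite [in RHS](aff_decomp f) dualP zu mulr0 add0r !dual_sum.
by apply: eq_bigr => i _; rewrite mulrC.
Qed.

Lemma hull_vecK z : z (aff1 A) = 0 -> vec_hull A (hull_vec z) = z.
Proof. by move=> /vec_hull_surj; apply: xgetPex. Qed.

End Hull.

(** * Existence and uniqueness of the Cayley-Menger form *)

Section CayleyMenger.
Context (R : realType) (V : vectType R) (A : affineType V) (m : Met A).
Implicit Types (v w : Aff (Quadm m)).
Implicit Types (d : Quadm m) (s : Aff A) (P Q : A) (x : V).

Lemma diff_mE v d s : diff_m v s = v (shift d s) - v d.
Proof. exact: lin_partE. Qed.

Lemma diff_mP a v w s : diff_m (a *: v + w) s = a * diff_m v s + diff_m w s.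
Proof.
have [d _] := Quadm_inhabited m; rewrite !(diff_mE _ d).
rewrite -[LHS]/((a * v (shift d s) + w (shift d s)) - (a * v d + w d)); ring.
Qed.

Lemma diff_m_eval_at P s : diff_m (eval_at m P) s = s P.
Proof.
have [d _] := Quadm_inhabited m; rewrite (diff_mE _ d).
by rewrite -[LHS]/((d P + s P) - d P); ring.
Qed.

(** The functionals of weight zero are those invariant under the addition of
    constants, and the evaluations at points have weight one; so each functional
    splits as a multiple of an evaluation plus an element of [Aff0]. *)
Definition weight v : R := diff_m v (aff1 A).

Lemma weightP a v w : weight (a *: v + w) = a * weight v + weight w.
Proof. exact: diff_mP. Qed.

Lemma weight_eval_at P : weight (eval_at m P) = 1.
Proof. by rewrite /weight diff_m_eval_at. Qed.

Lemma Aff0_weight v : Aff0 v <-> weight v = 0.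
Proof.
split=> [h|h d a].
  have [d _] := Quadm_inhabited m.
  by rewrite /weight (diff_mE _ d) -[aff1 A]scale1r h subrr.
apply/eqP; rewrite -subr_eq0 -diff_mE -[_ *: _]addr0 dualP -/(weight v) h.
by rewrite mulr0 add0r (diff_mE _ d) shift0 subrr.
Qed.

(** The component of [diff_m v] in the director space when the point [O]
    is taken to span a complement of it in the linear hull. *)
Definition dir O v : V := hull_vec (diff_m v - weight v *: point_hull O).

Lemma vec_hull_dir O v s :
  vec_hull A (dir O v) s = diff_m v s - weight v * s O.
Proof.
by rewrite hull_vecK // -[LHS]/(weight v - weight v * 1) mulr1 subrr.
Qed.

Lemma dirP O a v w : dir O (a *: v + w) = a *: dir O v + dir O w.
Proof.
apply: (@vec_hull_inj _ _ A); rewrite vec_hull_linear.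
apply/val_inj/funext => s.
rewrite -[RHS]/(a * vec_hull A (dir O v) s + vec_hull A (dir O w) s).
by rewrite [LHS]vec_hull_dir !vec_hull_dir diff_mP weightP; ring.
Qed.

Lemma dir_eval_at O P : dir O (eval_at m P) = vec O P.
Proof.
apply: (@vec_hull_inj _ _ A); rewrite vec_hull_vec; apply/val_inj/funext => s.
by rewrite [LHS]vec_hull_dir diff_m_eval_at weight_eval_at mul1r.
Qed.

Lemma dir_Aff0 O v : Aff0 v -> dir O v = hull_vec (diff_m v).
Proof. by move=> /Aff0_weight v0; rewrite /dir v0 scale0r subr0. Qed.

(** With [d0] centred at [O], and [x] and [y] the directions of [v] and [w],
    the form is [- g x y + weight v * w d0 + weight w * v d0]. The last two terms vanish on
    weight zero, and at [v = w = v_P] they add up to [2 * d0 P], which cancels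
    [g (vec O P) (vec O P)] because [d0] is centred. *)
Lemma CM_exists : exists b, is_CM (m := m) b.
Proof.
pose O := base_point A; pose g := hess_m m.
have gb : sym_bilinear g := hess_m_sym_bilinear m.
have [d0 d0E] := centred_exists m O.
have [ev evE] : exists ev : hull (Quadm m), forall v, ev v = v d0.
  by exists (point_hull d0).
exists (fun v w => - g (dir O v) (dir O w) + weight v * ev w + weight w * ev v).
split.
- split; first split=> u a v w /=.
  + by rewrite dirP weightP (sym_bilinP gb) (dualP ev); ring.
  + rewrite dirP weightP !(sym_bilinC gb (dir O u)).
    by rewrite (sym_bilinP gb) (dualP ev); ring.
  + by move=> v w; rewrite (sym_bilinC gb); ring.
- move=> v w v0 w0; rewrite !dir_Aff0 //.
  have /Aff0_weight -> := v0; have /Aff0_weight -> := w0.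
  by rewrite !mul0r !addr0.
- move=> P; rewrite dir_eval_at weight_eval_at.
  by rewrite evE [aff_fun _ _]d0E -/g; field.
Qed.

Lemma CM_is_CM : is_CM (CM m).
Proof. exact: xgetPex CM_exists. Qed.

Lemma weight0_const v : (forall s, diff_m v s = 0) ->
  exists c : R, v = c *: aff1 (Quadm m).
Proof.
move=> h; have [d _] := Quadm_inhabited m.
exists (v d); apply/val_inj/funext => e.
rewrite -[LHS]/(v e) -[RHS]/(v d * 1) mulr1 -(shift_vec d e).
by apply/eqP; rewrite -subr_eq0 -diff_mE h.
Qed.

(** Isotropy at [Q] and at [Q + x], with the vanishing on [Aff0], shows that
    [v_Q] is orthogonal to [v_(Q + x) - v_Q]. Adding the cases [x] and [- x]
    gives orthogonality to a constant functional, of value [hess_m m x x], which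
    is nonzero for a suitable [x]. Differences of evaluations and constants
    span [Aff0], so the isotropic [v_Q] is orthogonal to everything, and [v_Q]
    and [Aff0] together span all functionals. *)
Lemma CM_vanish (e : Aff (Quadm m) -> Aff (Quadm m) -> R) :
  m <> 0 -> sym_bilinear e -> (forall v w, Aff0 v -> Aff0 w -> e v w = 0) ->
  (forall P, e (eval_at m P) (eval_at m P) = 0) -> forall v w, e v w = 0.
Proof.
move=> m0 eb e0 eP; pose Q := base_point A; pose q := eval_at m Q.
(* Written as [a *: v + w] so that [weightP] and [diff_mP] apply. *)
pose u x := - 1 *: q + eval_at m (shift Q x).
have u0 x : Aff0 (u x).
  by apply/Aff0_weight; rewrite weightP !weight_eval_at; ring.
have equ x : e q (u x) = 0.
  have := eP (shift Q x); have -> : eval_at m (shift Q x) = q + u x.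
    by rewrite /u addrA scaleN1r subrr add0r.
  rewrite (sym_bilinDl eb) !(sym_bilinDr eb q (u x)) eP (e0 _ _ (u0 x) (u0 x)).
  by rewrite (sym_bilinC eb _ q); lra.
have eq1 : e q (aff1 _) = 0.
  have [x gx] := hess_m_neq0 m0.
  have ux : u x + u (- x) = hess_m m x x *: aff1 (Quadm m).
    apply/val_inj/funext => d.
    rewrite -[RHS]/(hess_m m x x * 1) -(hess_m_diff2 d Q).
    rewrite -[LHS]/((- 1 * d Q + d (shift Q x)) +
                    (- 1 * d Q + d (shift Q (- x)))).
    ring.
  have : e q (u x + u (- x)) = 0 by rewrite (sym_bilinDr eb) !equ addr0.
  by rewrite ux (sym_bilinZr eb) => /eqP; rewrite mulf_eq0 => /orP[/eqP|/eqP].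
have eq0 v : Aff0 v -> e q v = 0.
  move=> v0; pose x := hull_vec (diff_m v).
  have [c cE] : exists c : R, - 1 *: u x + v = c *: aff1 (Quadm m).
    apply: weight0_const => s; rewrite !diff_mP !diff_m_eval_at.
    have : vec_hull A x s = diff_m v s.
      by rewrite hull_vecK //; apply/Aff0_weight.
    rewrite vec_hullE (lin_partE _ Q) => <-; ring.
  have -> : v = u x + c *: aff1 (Quadm m).
    by rewrite -cE scaleN1r addrA subrr add0r.
  by rewrite (sym_bilinDr eb) (sym_bilinZr eb) equ eq1 mulr0 addr0.
have split_q v : exists2 v', Aff0 v' & v = weight v *: q + v'.
  exists (- weight v *: q + v); last by rewrite addrA scaleNr subrr add0r.
  by apply/Aff0_weight; rewrite weightP weight_eval_at; ring.
move=> v w; have [v' v0 ->] := split_q v; have [w' w0 ->] := split_q w.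
rewrite (sym_bilinP eb) !(sym_bilinDr eb) !(sym_bilinZr eb) eP.
rewrite (sym_bilinC eb v').
by rewrite !eq0 // (e0 v' w') //; ring.
Qed.

Lemma CM_unique b c : m <> 0 -> is_CM (m := m) b -> is_CM (m := m) c ->
  forall v w, b v w = c v w.
Proof.
move=> m0 [bb b0 bP] [cb c0 cP] v w; apply/eqP; rewrite -subr_eq0; apply/eqP.
apply: (@CM_vanish (fun v w => b v w - c v w)) => //.
- split; first split=> u a x y /=.
  + by rewrite (sym_bilinP bb) (sym_bilinP cb); ring.
  + rewrite !(sym_bilinC bb u, sym_bilinC cb u).
    by rewrite (sym_bilinP bb) (sym_bilinP cb); ring.
  + by move=> x y; rewrite (sym_bilinC bb) (sym_bilinC cb).
- by move=> x y x0 y0; rewrite b0 // c0 // subrr.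
- by move=> P; rewrite bP cP subrr.
Qed.

End CayleyMenger.

(** * Naturality *)

Section Pullback.
Context (R : realType) (V W : vectType R) (A : affineType V) (B : affineType W).
Context (phi : affine_map B A) (m : Met A).
Implicit Types (v w : Aff (Quadm (met_pull phi m))).

Lemma diff_m_pull v s :
  diff_m (quad_pull_dual phi m v) s = diff_m v (aff_pull phi s).
Proof.
have [d _] := Quadm_inhabited m.
rewrite (diff_mE _ d) (diff_mE _ (quadm_pull phi m d)) /=.
congr (v _ - _); by do 2!apply/val_inj; apply/funext.
Qed.

Lemma Aff0_pull v : Aff0 v -> Aff0 (quad_pull_dual phi m v).
Proof.
move=> /Aff0_weight h; apply/Aff0_weight; rewrite /weight diff_m_pull -h.
by congr (diff_m v _); apply/val_inj/funext.
Qed.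

(** The differential of the dual pullback is the linear part of [phi], seen
    through the embeddings of the director spaces in the hulls. *)
Lemma hull_vec_pull P v : Aff0 v -> hull_vec (diff_m (quad_pull_dual phi m v)) =
  diff_map phi P (hull_vec (diff_m v)).
Proof.
move=> v0; apply: (@vec_hull_inj _ _ A); rewrite hull_vecK; last first.
  exact/Aff0_weight/Aff0_pull.
apply/val_inj/funext => s; rewrite [LHS]diff_m_pull [RHS]vec_hullE.
rewrite (lin_partE _ (phi P)) -diff_mapE.
have /Aff0_weight := v0 => /hull_vecK {1}<-.
by rewrite vec_hullE (lin_partE _ P).
Qed.

(** The two defining properties are transported because the hessian of the
    induced metric is the pullback of the hessian of [m], and because the dual
    pullback sends evaluation at [P] to evaluation at [phi P]. *)
Lemma is_CM_pull b : is_CM (m := m) b ->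
  is_CM (fun v w => b (quad_pull_dual phi m v) (quad_pull_dual phi m w)).
Proof.
move=> [bb b0 bP].
have pullP a v w : quad_pull_dual phi m (a *: v + w) =
    a *: quad_pull_dual phi m v + quad_pull_dual phi m w.
  by apply/val_inj/funext.
split.
- split; first split=> u a x y /=.
  + by rewrite pullP (sym_bilinP bb).
  + by rewrite pullP !(sym_bilinC bb (quad_pull_dual phi m u)) (sym_bilinP bb).
  + by move=> x y; apply: sym_bilinC.
- move=> v w v0 w0; rewrite b0; try exact: Aff0_pull.
  by rewrite !(hull_vec_pull (base_point B)) // -hess_m_pull.
- move=> P; rewrite -(bP (phi P)).
  suff -> : quad_pull_dual phi m (eval_at _ P) = eval_at m (phi P) by [].
  by apply/val_inj/funext.
Qed.

End Pullback.

Theorem theorem5p27 (R : realType) (V W : vectType R)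
    (A : affineType V) (B : affineType W) (phi : affine_map B A) (m : Met A)
    (m_phi_neq0 : met_pull phi m <> 0) (v w : Aff (Quadm (met_pull phi m))) :
  CM (met_pull phi m) v w = CM m (quad_pull_dual phi m v) (quad_pull_dual phi m w).
Proof.
have CM_pull := is_CM_pull phi (CM_is_CM m).
exact: (CM_unique m_phi_neq0 (CM_is_CM _) CM_pull).
Qed.
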